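(* Let $k$ be an algebraically closed field of characteristic zero, let $n\ge 1$, let $D$ be a simple $k$-derivation of the polynomial ring $k[x_1,\dots,x_n]$, and let $\rho\in \mathrm{Aut}(k[x_1,\dots,x_n])_D$. Suppose that there exists a maximal ideal $\mathfrak{m}\subset k[x_1,\dots,x_n]$ such that $\rho(\mathfrak{m})=\mathfrak{m}$. Then $\rho=\mathrm{id}$.
   Context: A $k$-derivation of a $k$-algebra $A$ is a $k$-linear map $d:A\to A$ with $d(fg)=d(f)g+f\,d(g)$ for all $f,g\in A$. A derivation $d$ of $A=k[x_1,\dots,x_n]$ is called simple if the only ideals $I$ of $A$ with $d(I)\subset I$ are $0$ and $A$. $\mathrm{Aut}(A)$ is the group of $k$-algebra automorphisms of $A$, and the isotropy group of $D$ is $\mathrm{Aut}(A)_D=\{\rho\in\mathrm{Aut}(A) : \rho\circ D=D\circ\rho\}$. *)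

(* Defs.v *)
From mathcomp Require Import all_boot all_algebra.
From mathcomp Require Import classical_sets.
From mathcomp Require Export mpoly.

Set Implicit Arguments.
Unset Strict Implicit.
Unset Printing Implicit Defensive.

Import GRing.Theory.

Local Open Scope ring_scope.
Local Open Scope classical_set_scope.

Section Ideals.
Variable A : comNzRingType.

Definition is_ideal (I : set A) : Prop :=
  [/\ I 0,
      forall f g, I f -> I g -> I (f + g)
    & forall f g, I g -> I (f * g)].

Definition is_maximal_ideal (m : set A) : Prop :=
  [/\ is_ideal m,
      m <> setT
    & forall J : set A, is_ideal J -> m `<=` J -> J = m \/ J = setT].

End Ideals.

Section Derivations.
Variables (k : comNzRingType) (A : comAlgType k).

(* k-linearity is carried by the type of d. *)
Definition is_derivation (d : {linear A -> A}) : Prop :=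
  forall f g : A, d (f * g) = d f * g + f * d g.

Definition is_simple (d : {linear A -> A}) : Prop :=
  forall I : set A, is_ideal I -> d @` I `<=` I -> I = [set 0] \/ I = setT.

Definition alg_aut : set {lrmorphism A -> A} :=
  [set rho | bijective rho].

Definition isotropy (d : {linear A -> A}) : set {lrmorphism A -> A} :=
  [set rho | alg_aut rho /\ rho \o d =1 d \o rho].

End Derivations.

(* Main.v *)
(* By Zariski's lemma, A / m = k for A = k[x_1, ..., x_n], so every f is a
   constant plus an element of m; as rho fixes constants and preserves m, this
   puts rho f - f in m for every f.  Since rho commutes with D, also
   D^i (rho f - f) = rho (D^i f) - D^i f lies in m for every i.  The elements
   all of whose iterated derivatives lie in m form a D-stable ideal contained
   in m, hence the zero ideal by simplicity, and rho f = f.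

   Zariski's lemma is proved along Goldman domains: if a field K is finitely
   generated as a ring over R, then a single element of R can be inverted to
   make the image of R a field; applied to R = k[x] this forces x to be
   algebraic over k. *)

Require Import Defs.
From HB Require Import structures.
From mathcomp Require Import all_boot all_algebra.
From mathcomp Require Import boolp classical_sets.
From mathcomp Require Import mpoly.

Set Implicit Arguments.
Unset Strict Implicit.
Unset Printing Implicit Defensive.

Import GRing.Theory.

Local Open Scope ring_scope.
Local Open Scope classical_set_scope.

(** * Algebraic elements and adjunction along ring maps into a field *)

Definition algebraic_over (R : comNzRingType) (K : fieldType)
    (phi : {rmorphism R -> K}) (x : K) : Prop :=
  exists2 p : {poly R}, map_poly phi p != 0 & root (map_poly phi p) x.

(** The subring [R[x]] of [K] is represented by the evaluation map, so that adjunction can be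
    iterated on maps without forming subrings. *)
Definition adjoin (R : comNzRingType) (K : fieldType)
    (phi : {rmorphism R -> K}) (x : K) : {rmorphism {poly R} -> K} :=
  horner_morph (fun a => mulrC x (phi a)).

Lemma adjoinE (R : comNzRingType) (K : fieldType) (phi : {rmorphism R -> K})
    (x : K) (p : {poly R}) : adjoin phi x p = (map_poly phi p).[x].
Proof. by []. Qed.

Lemma adjoinC (R : comNzRingType) (K : fieldType) (phi : {rmorphism R -> K})
    (x : K) (a : R) : adjoin phi x a%:P = phi a.
Proof. by rewrite adjoinE map_polyC hornerC. Qed.

Lemma adjoinX (R : comNzRingType) (K : fieldType) (phi : {rmorphism R -> K})
    (x : K) : adjoin phi x 'X = x.
Proof. by rewrite adjoinE map_polyX hornerX. Qed.

(* The image of phi becomes a field after inverting the single element phi r,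
   as in Goldman domains. *)
Definition goldman (R : comNzRingType) (K : fieldType)
    (phi : {rmorphism R -> K}) : Prop :=
  exists2 r, phi r != 0 &
    forall s, phi s != 0 -> exists t N, phi s * phi t = phi r ^+ N.

(** * Descent of the Goldman property *)

Lemma integral_adjoin (R : comNzRingType) (K : fieldType)
    (phi : {rmorphism R -> K}) (x : K) (p : {poly R}) :
  integralOver phi x -> integralOver phi (adjoin phi x p).
Proof.
move=> x_int; rewrite adjoinE; apply: integral_horner => //.
by apply/integral_poly => i; rewrite coef_map; apply: integral_id.
Qed.

(** As [y] is nonzero, factors ['X] can be cancelled from its equation until the constant term has
    nonzero image; [y] then divides that term. *)
Lemma algebraic_dvd_base (R : comNzRingType) (K : fieldType)
    (phi : {rmorphism R -> K}) (y : K) :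
    y != 0 -> algebraic_over phi y ->
  exists u b, phi b != 0 /\ y * adjoin phi y u = phi b.
Proof.
move=> y0 [p]; elim/poly_ind: p => [|p c IH].
  by rewrite rmorph0 eqxx.
have [c0|c0] := eqVneq (phi c) 0.
  rewrite rmorphD rmorphM /= map_polyX map_polyC /= c0 addr0.
  rewrite mulf_eq0 polyX_eq0 orbF => p0; rewrite rootM rootX (negPf y0) orbF.
  exact: IH.
move=> _; rewrite /root -adjoinE rmorphD rmorphM /= adjoinC adjoinX => /eqP e.
exists (- p), c; split=> //; apply/eqP.
by rewrite rmorphN mulrN mulrC eq_sym -addr_eq0 addrC e.
Qed.

Lemma integral_algebraic_over (R : comNzRingType) (K : fieldType)
    (phi : {rmorphism R -> K}) (y : K) :
  integralOver phi y -> algebraic_over phi y.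
Proof.
by case=> p mon_p py; exists p => //; rewrite monic_neq0 // monic_map.
Qed.

(* Clearing denominators in the monic equation of phi c / phi s. *)
Lemma integral_fraction (R : comNzRingType) (K : fieldType)
    (phi : {rmorphism R -> K}) (z : K) (s c : R) :
    integralOver phi z -> phi s != 0 -> phi s * z = phi c ->
  exists t N, phi s * phi t = phi c ^+ N.
Proof.
case=> p mon_p pz s0 sz.
pose d := (size p).-1.
have sp : size p = d.+1 by rewrite prednK // size_poly_gt0 monic_neq0.
exists (- \sum_(i < d) p`_i * s ^+ (d.-1 - i) * c ^+ i), d.
have := congr1 ( *%R (phi s ^+ d)) (eqP pz).
have sq : size (map_poly phi p) = d.+1.
  by rewrite size_map_poly_id0 //; rewrite (monicP mon_p) rmorph1 oner_neq0.
rewrite mulr0 horner_coef sq big_ord_recr /= mulrDr.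
have -> : (map_poly phi p)`_d = 1.
  by rewrite coef_map -[d]/((size p).-1) -lead_coefE (monicP mon_p) /= rmorph1.
rewrite mul1r -exprMn sz => /eqP; rewrite addrC addr_eq0 => /eqP ->.
rewrite rmorphN rmorph_sum mulrN; congr (- _); rewrite !mulr_sumr.
apply: eq_bigr => i _; rewrite coef_map !rmorphM !rmorphXn /= -sz exprMn.
have -> : phi s ^+ d = phi s * phi s ^+ (d.-1 - i) * phi s ^+ i.
  rewrite -exprS -exprD addSn.
  by rewrite subnK; case: (d) i => [|e] [] //= *; rewrite -ltnS.
rewrite -!mulrA; congr (_ * _); rewrite [LHS]mulrCA; congr (_ * _).
exact: mulrCA.
Qed.

(** The inverting element [r] of [R[x]] is integral, hence divides some [phi b], and [b] serves for
    [R]: the cofactor of [s] in a power of [phi b] is integral over [R], and [integral_fraction]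
    replaces it by an element of [R]. *)
Lemma goldman_integral (R : comNzRingType) (K : fieldType)
    (phi : {rmorphism R -> K}) (x : K) :
  integralOver phi x -> goldman (adjoin phi x) -> goldman phi.
Proof.
move=> x_int [r r0 rP].
have y_int := integral_adjoin r x_int.
have [u [b [b0 yb]]] := algebraic_dvd_base r0 (integral_algebraic_over y_int).
exists b => // s s0.
have [|t [N e]] := rP s%:P; first by rewrite adjoinC.
rewrite adjoinC in e.
set y := adjoin phi x r in y_int yb e.
have w_int := integral_adjoin u y_int; set w := adjoin phi y u in yb w_int.
have wN_int : integralOver phi (w ^+ N).
  by elim: (N) => [|j IH]; rewrite ?exprS;
    [apply: integral1 | apply: integral_mul].
have z_int := integral_mul (integral_adjoin t x_int) wN_int.
have [||t' [M e']] := integral_fraction (s := s) (c := b ^+ N) z_int => //.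
  by rewrite mulrA e -exprMn yb rmorphXn.
by exists t', (N * M)%N; rewrite e' rmorphXn exprM.
Qed.

Lemma goldman_localization (R1 R2 : comNzRingType) (K : fieldType)
    (f : {rmorphism R1 -> K}) (g : {rmorphism R2 -> K}) (l : R2) :
    g l != 0 -> (forall s, exists s', f s' = g s) ->
    (forall y, exists y' N, f y * g l ^+ N = g y') ->
  goldman f -> goldman g.
Proof.
move=> l0 g_sub clear [r r0 rP].
have [r' [M er]] := clear r.
exists (r' * l) => [|s s0].
  by rewrite rmorphM mulf_neq0 // -er mulf_neq0 ?expf_neq0.
have [s' es] := g_sub s.
have [|t [N e]] := rP s'; first by rewrite es.
have [t' [P et]] := clear t.
(* The factor [l ^+ (M * N)] turns the power [r ^+ N] into [r' ^+ N]; the other two balance the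
   power [l ^+ P] contained in [t'], leaving a power of [r' * l]. *)
exists (t' * l ^+ (M * N) * r' ^+ P * l ^+ N), (N + P)%N.
rewrite !rmorphM !rmorphXn /= exprMn [g r' ^+ (N + P)]exprD -{2}er exprMn -e es.
rewrite -et exprM !exprD -!mulrA; do 2![congr (_ * _)].
by rewrite mulrC -!mulrA.
Qed.

Lemma adjoin_clear (R : comNzRingType) (K : fieldType)
    (phi : {rmorphism R -> K}) (x : K) (l : R) (p : {poly R}) :
  exists p' N, adjoin phi x p * phi l ^+ N = adjoin phi (phi l * x) p'.
Proof.
elim/poly_ind: p => [|p c [p' [N e]]].
  by exists 0, 0%N; rewrite !rmorph0 mul0r.
exists (p' * 'X + (c * l ^+ N.+1)%:P), N.+1.
rewrite !rmorphD !rmorphM /= !adjoinC !adjoinX -e rmorphXn mulrDl.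
by congr (_ + _); rewrite exprSr mulrACA [x * _]mulrC.
Qed.

Lemma adjoin_scale (R : comNzRingType) (K : fieldType)
    (phi : {rmorphism R -> K}) (x : K) (l : R) (p : {poly R}) :
  adjoin phi x (p \Po (l%:P * 'X)) = adjoin phi (phi l * x) p.
Proof.
rewrite !adjoinE map_comp_poly horner_comp -(adjoinE phi x) rmorphM.
by rewrite adjoinC adjoinX.
Qed.

Lemma algebraic_integral_multiple (R : comNzRingType) (K : fieldType)
    (phi : {rmorphism R -> K}) (x : K) :
  algebraic_over phi x ->
  exists2 l, phi l != 0 & integralOver phi (phi l * x).
Proof.
case=> p; set q := map_poly phi p => q0 qx.
have : (1 < size q)%N by apply: root_size_gt1 qx.
case sq : (size q) => [|[|d]] // _.
(* The coefficient is taken at the degree of the image [q]: the leading coefficient of [p] itself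
   may be killed by [phi]. *)
pose l := p`_d.+1.
have lE : phi l = lead_coef q by rewrite lead_coefE sq coef_map.
have l0 : phi l != 0 by rewrite lE lead_coef_eq0.
exists l => //.
(* Multiplying the equation of degree [d.+1] by the [d]-th power of [phi l] makes it monic in
   [phi l * x]. *)
exists ('X^(d.+1) + \poly_(i < d.+1) (p`_i * l ^+ (d - i))).
  rewrite monicE lead_coefDl ?lead_coefXn //.
  by rewrite size_polyXn ltnS size_poly.
rewrite /root -adjoinE rmorphD rmorphXn /= adjoinX adjoinE.
have -> : map_poly phi (\poly_(i < d.+1) (p`_i * l ^+ (d - i))) =
    \poly_(i < d.+1) (phi p`_i * phi l ^+ (d - i)).
  apply/polyP => i; rewrite coef_map !coef_poly /=.
  by case: ifP => _; rewrite ?rmorph0 // rmorphM rmorphXn.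
have := congr1 ( *%R (phi l ^+ d)) (eqP qx).
rewrite mulr0 horner_coef sq big_ord_recr /= => <-.
rewrite horner_poly addrC mulrDr mulr_sumr; apply/eqP; congr (_ + _).
  by rewrite /q coef_map -/l exprMn exprSr -mulrA.
apply: eq_bigr => i _; rewrite /q coef_map exprMn /=.
have -> : phi l ^+ d = phi l ^+ (d - i) * phi l ^+ i.
  by rewrite -exprD subnK // -ltnS.
by rewrite -!mulrA mulrCA; congr (_ * _); rewrite mulrCA.
Qed.

(* In a polynomial ring 1 + X r is coprime to r, so it does not divide a
   power of r unless it is constant. *)
Lemma goldman_algebraic (R : comNzRingType) (K : fieldType)
    (phi : {rmorphism R -> K}) (x : K) :
  goldman (adjoin phi x) -> algebraic_over phi x.
Proof.
case=> r r0 rP; pose s := 1 + 'X * r.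
have q0 : map_poly phi r != 0.
  by apply: contraNneq r0; rewrite adjoinE => ->; rewrite horner0.
have sE : map_poly phi s = 1 + 'X * map_poly phi r.
  by rewrite rmorphD rmorph1 rmorphM /= map_polyX.
have size_s : (1 < size (map_poly phi s))%N.
  rewrite sE addrC size_polyDl mulrC size_mulX // ?size_poly1 ltnS.
    by rewrite size_poly_gt0.
  by rewrite size_poly_gt0.
have [sx|sx] := eqVneq (adjoin phi x s) 0.
  exists s; first by rewrite -size_poly_gt0 ltnW.
  by rewrite /root -adjoinE sx.
have [t [N e]] := rP s sx.
(* The Goldman relation for [s] vanishes at [x]; it is a nonzero polynomial by coprimality. *)
exists (s * t - r ^+ N); last first.
  by rewrite /root -adjoinE rmorphB rmorphM rmorphXn /= e subrr.
rewrite rmorphB rmorphM rmorphXn /= subr_eq0; apply/negP => /eqP eq.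
have : coprimep (map_poly phi s) (map_poly phi r ^+ N).
  apply: coprimep_expr; apply/Bezout_eq1_coprimepP.
  by exists (1, - 'X) => /=; rewrite sE mul1r mulNr addrK.
move/coprimepP/(_ (map_poly phi s) (dvdpp _)).
rewrite -eq dvdp_mulr // => /(_ isT).
by rewrite -size_poly_eq1 => /eqP s1; rewrite s1 in size_s.
Qed.

(** * Zariski's lemma *)

Definition generates (R : comNzRingType) (K : fieldType)
    (phi : {rmorphism R -> K}) (xs : seq K) : Prop :=
  forall S : set K,
    range phi `<=` S -> (forall x, x \in xs -> S x) ->
    (forall y z, S y -> S z -> S (y + z)) ->
    (forall y z, S y -> S z -> S (y * z)) ->
  S = setT.

(** The inclusion covers two uses: moving a generator into the base ring, and adjoining an arbitrary
    element while keeping all generators. *)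
Lemma generates_adjoin (R : comNzRingType) (K : fieldType)
    (phi : {rmorphism R -> K}) (x : K) (xs ys : seq K) :
    {subset xs <= x :: ys} ->
  generates phi xs -> generates (adjoin phi x) ys.
Proof.
move=> xs_ys gen S Sphi Sxs SD SM; apply: gen => //.
  by move=> _ [a _ <-]; apply: Sphi; exists a%:P => //; rewrite adjoinC.
move=> y /xs_ys; rewrite in_cons => /predU1P[->|]; last exact: Sxs.
by apply: Sphi; exists 'X => //; rewrite adjoinX.
Qed.

(** Induction on the generators, for all base rings at once: [R[x]] is Goldman, so [x] is algebraic
    and some [phi l * x] is integral. The property passes from [R[x]] to [R[l x]], which agree after
    inverting [l], and then to [R]. *)
Lemma generates_goldman (K : fieldType) (xs : seq K) (R : comNzRingType)
    (phi : {rmorphism R -> K}) : generates phi xs -> goldman phi.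
Proof.
elim: xs R phi => [|x xs IH] R phi gen.
  have phi_surj : range phi = setT.
    apply: gen => // _ _ [a _ <-] [b _ <-].
      by exists (a + b) => //; rewrite rmorphD.
    by exists (a * b) => //; rewrite rmorphM.
  exists 1 => [|s s0]; first by rewrite rmorph1 oner_neq0.
  have [t _ et] : range phi (phi s)^-1 by rewrite phi_surj.
  by exists t, 0%N; rewrite et mulfV.
have G := IH _ _ (generates_adjoin (fun y => id) gen).
have [l l0 l_int] := algebraic_integral_multiple (goldman_algebraic G).
apply: (goldman_integral l_int).
apply: (goldman_localization (l := l%:P) _ _ _ G) => [|s|y].
- by rewrite adjoinC.
- by exists (s \Po (l%:P * 'X)); rewrite adjoin_scale.
- by rewrite adjoinC; apply: adjoin_clear.
Qed.

Lemma generates_algebraic (R : comNzRingType) (K : fieldType)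
    (phi : {rmorphism R -> K}) (xs : seq K) (x : K) :
  generates phi xs -> algebraic_over phi x.
Proof.
move=> gen; apply: goldman_algebraic; apply: (generates_goldman (xs := xs)).
by apply: generates_adjoin gen => y yxs; rewrite in_cons yxs orbT.
Qed.

Lemma algebraic_closed_field (k : closedFieldType) (K : fieldType)
    (phi : {rmorphism k -> K}) (x : K) :
  algebraic_over phi x -> exists a, x = phi a.
Proof.
case=> p; have [rs ->] := closed_field_poly_normal p.
rewrite linearZ /= rmorph_prod /= => p0.
rewrite rootZ; last first.
  by apply: contraNneq p0 => ->; rewrite scale0r.
rewrite /root horner_prod prodf_seq_eq0 => /hasP[a _ /=].
rewrite rmorphB /= map_polyX map_polyC hornerXsubC subr_eq0 => /eqP.
by exists a.
Qed.

(** * Residue fields of maximal ideals and the Nullstellensatz *)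

Lemma maximal_ideal_residue_field (A : comNzRingType) (m : set A) :
    is_maximal_ideal m ->
  exists (K : fieldType) (pi : {rmorphism A -> K}),
    range pi = setT /\ forall a, pi a = 0 <-> m a.
Proof.
case=> [[m0 mD mM] m_proper m_max].
have m1 : ~ m 1.
  move=> m1; apply: m_proper; apply/seteqP; split=> // a _.
  by rewrite -[a]mulr1; apply: mM.
have m_closed : idealr_closed (fun a => `[< m a >]).
  split; [exact/asboolP | exact/asboolPn |].
  by move=> a u v /asboolP mu /asboolP mv; apply/asboolP/mD => //; apply: mM.
pose I : idealr A := HB.pack (fun a => `[< m a >])
  (isIdealr.Build A _ m_closed).
pose Q : comNzRingType := {ideal_quot I}.
pose pi : {rmorphism A -> Q} := \pi_({ideal_quot I})%qT.
have pi0 a : pi a = 0 <-> m a.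
  rewrite -(rmorph0 pi); split.
    by move=> /eqP; rewrite -Quotient.idealrBE subr0 => /asboolP.
  by move=> ma; apply/eqP; rewrite -Quotient.idealrBE subr0; apply/asboolP.
have pi_surj (y : Q) : exists a, pi a = y.
  by exists (repr y); apply: reprK.
(* Both clauses are put in one existence statement so that choice yields an inverse function with
   value 0 at 0. *)
have inv_ex (y : Q) : exists z, (y != 0 -> z * y = 1) /\ (y = 0 -> z = 0).
  have [->|y0] := eqVneq y 0; first by exists 0.
  have [a ea] := pi_surj y.
  (* [J] is the ideal generated by [m] and [a]; since [a] is outside [m], maximality gives
     [1 = b + d * a], and [d] inverts [a] modulo [m]. *)
  pose J : set A := [set c | exists2 b, m b & exists d, c = b + d * a].
  have [||JE|JE] := m_max J.
  - split.
    + by exists 0 => //; exists 0; rewrite mul0r addr0.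
    + move=> _ _ [b mb [d ->]] [b' mb' [d' ->]].
      exists (b + b'); first exact: mD.
      by exists (d + d'); rewrite mulrDl addrACA.
    + move=> f _ [b mb [d ->]]; exists (f * b); first exact: mM.
      by exists (f * d); rewrite mulrDr mulrA.
  - by move=> b mb; exists b => //; exists 0; rewrite mul0r addr0.
  - case/eqP: y0; rewrite -ea; apply/pi0; rewrite -JE.
    by exists 0 => //; exists 1; rewrite mul1r add0r.
  - have [b mb [d e]] : J 1 by rewrite JE.
    exists (pi d); split=> [_|y_eq]; last by rewrite y_eq eqxx in y0.
    by rewrite -ea -rmorphM -(rmorph1 pi) e rmorphD (pi0 b).2 ?add0r.
pose inv y := projT1 (cid (inv_ex y)).
have mulVf (y : Q) : y != 0 -> inv y * y = 1.
  by move=> y0; rewrite /inv; case: cid => z /= [->].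
have inv0 : inv 0 = 0 by rewrite /inv; case: cid => z /= [_ ->].
pose K : fieldType := HB.pack Q (GRing.ComNzRing_isField.Build Q mulVf inv0).
exists K, pi; split=> //; apply/seteqP; split=> // y _.
by have [a <-] := pi_surj y; exists a.
Qed.

Lemma generates_mpoly (n : nat) (k : comNzRingType) (K : fieldType)
    (pi : {rmorphism {mpoly k[n]} -> K}) :
    range pi = setT ->
  generates (pi \o @mpolyC n k) [seq pi 'X_i | i <- enum 'I_n].
Proof.
move=> pi_surj S Sk Sx SD SM; apply/seteqP; split=> // y _.
have [f _ <-] : range pi y by rewrite pi_surj.
have SX i : S (pi 'X_i) by apply/Sx/map_f; rewrite mem_enum.
have SC c : S (pi c%:MP) by apply: Sk; exists c.
elim/mpolyind: f => [|c m f _ _ IH]; first by rewrite -mpolyC0.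
rewrite rmorphD; apply: SD => //; rewrite -mul_mpolyC rmorphM.
apply: (SM) => //; rewrite mpolyXE_id rmorph_prod /=.
apply: (big_ind S) => [|z t|i _]; [|exact: SM|].
  by rewrite -(rmorph1 pi) -mpolyC1.
elim: (m i) => [|j IHj]; first by rewrite expr0 -mpolyC1.
by rewrite exprS rmorphM; apply: SM.
Qed.

Lemma nullstellensatz (k : closedFieldType) (n : nat) (m : set {mpoly k[n]}) :
  is_maximal_ideal m -> forall f, exists c : k, m (f - c%:MP).
Proof.
move=> /maximal_ideal_residue_field[K [pi [pi_surj pi0]]] f.
have gen := generates_mpoly pi_surj.
have [c e] := algebraic_closed_field (generates_algebraic (pi f) gen).
by exists c; apply/pi0; rewrite rmorphB e subrr.
Qed.

(** * Simple derivations and automorphisms preserving a maximal ideal *)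

Lemma is_simple_eq0 (k : comNzRingType) (A : comAlgType k)
    (D : {linear A -> A}) (m : set A) (f : A) :
    is_derivation D -> is_simple D -> is_ideal m -> m <> setT ->
  (forall i, m (iter i D f)) -> f = 0.
Proof.
move=> D_der D_simple [m0 mD mM] m_proper mf.
pose I : set A := [set g | forall i, m (iter i D g)].
have iterD i : {morph iter i D : g h / g + h}.
  by elim: i => // i IH g h; rewrite !iterS IH linearD.
have Im : I `<=` m by move=> g /(_ 0%N).
have I_ideal : is_ideal I.
  split.
  - by elim=> // i IH; rewrite iterSr linear0.
  - by move=> g h Ig Ih i; rewrite iterD; apply: mD.
  (* By the Leibniz rule the next derivative of [g * h] splits into terms with [h] and [D h] as
     factors, both in [I]; hence the induction ranges over all [g] and [h]. *)
  - move=> g h Ih i; elim: i g h Ih => [|i IH] g h Ih.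
      by apply: mM; apply: Im.
    rewrite iterSr D_der iterD; apply: mD; apply: IH => // j.
    by rewrite -iterSr.
have ID : D @` I `<=` I by move=> _ [g Ig <-] i; rewrite -iterSr.
have [I0|IT] := D_simple I I_ideal ID.
  by have : I f by []; rewrite I0.
by case: m_proper; apply/seteqP; split=> // g _; apply: Im; rewrite IT.
Qed.

Theorem proposition7 (k : closedFieldType) (k_char0 : [pchar k] =i pred0)
    (n : nat) (n_ge1 : (1 <= n)%N)
    (D : {linear {mpoly k[n]} -> {mpoly k[n]}})
    (D_der : is_derivation D) (D_simple : is_simple D)
    (rho : {lrmorphism {mpoly k[n]} -> {mpoly k[n]}})
    (rho_isotropy : isotropy D rho)
    (ex_fixed : exists m : set {mpoly k[n]},
        is_maximal_ideal m /\ rho @` m = m) :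
  rho =1 id.
Proof.
case: ex_fixed rho_isotropy => m [m_max rho_m] [_ rhoD] f.
have [m_ideal m_proper _] := m_max; have [_ mD mM] := m_ideal.
apply/eqP; rewrite -subr_eq0; apply/eqP.
apply: (is_simple_eq0 D_der D_simple m_ideal m_proper) => i.
have -> : iter i D (rho f - f) = rho (iter i D f) - iter i D f.
  elim: i => // i IH; rewrite !iterS IH linearB; congr (_ - _).
  by have /= := rhoD (iter i D f).
have [c mc] := nullstellensatz m_max (iter i D f).
(* The constant [c] is fixed by [rho] and cancels; the sign is written as a product with [-1] to
   match the ideal axioms. *)
have -> : rho (iter i D f) - iter i D f =
    rho (iter i D f - c%:MP) + (-1) * (iter i D f - c%:MP).
  rewrite rmorphB mulN1r /= -!alg_mpolyC.
  by rewrite rmorph_alg opprB addrA subrK.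
by apply: mD; [rewrite -rho_m; exists (iter i D f - c%:MP) | apply: mM].
Qed.
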